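(* Let $\mu$ be a countably additive Borel non-negative measure of bounded variation (i.e. finite) on $\mathbb{R}$, and consider the system of harmonic oscillators with phase space $H=L^2(\mathbb{R},\mu,\mathbb{C})$ and flow $(\mathbf{\Phi}_tv)(x)=e^{itx}v(x)$, $t,x\in\mathbb{R}$. If there exists a transitive trajectory $\Gamma_u=\{\mathbf{\Phi}_tu: t\in\mathbb{R}\}$ of this system, then there must exist a Borel set $A\subset\mathbb{R}$ with $\mu|_A\neq0$ such that $$\limsup_{t\to\infty}|\widehat{\mu|_A}(t)|=\|\mu|_A\|>0.$$
   Context: $\hat\nu(\xi)=\int_{\mathbb{R}}e^{-i\xi x}\,d\nu(x)$ denotes the Fourier transform of a finite Borel measure $\nu$ on $\mathbb{R}$, and $\|\nu\|$ its total variation. For a Borel set $A$, $\mu|_A(B)=\mu(A\cap B)$. For $u\in H$, the invariant torus is $\mathbb{T}_u=\{v\in H:|v(x)|=|u(x)|\text{ for }\mu\text{-a.e. }x\}$, with the topology induced from the norm of $H$. The trajectory $\Gamma_u$ is transitive if it is dense in $\mathbb{T}_u$.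
   Formalization: The transitive trajectory is required to start at a nonzero u; for u = 0 the torus and trajectory are both {0}, so the claim as written fails, for example for Lebesgue measure on [0,1]. *)

(* Defs.v *)
From HB Require Import structures.
From mathcomp Require Import all_boot all_order all_algebra.
From mathcomp Require Import all_classical all_reals all_analysis.
From mathcomp Require Import measurable_realfun complex ring_quotient.

Set Implicit Arguments.
Unset Strict Implicit.
Unset Printing Implicit Defensive.

Import Order.TTheory GRing.Theory Num.Theory.
Import numFieldNormedType.Exports.
Import ComplexField.Normc.

Local Open Scope classical_set_scope.
Local Open Scope ring_scope.
Local Open Scope quotient_scope.
Local Open Scope complex_scope.

Section L2_functions.
Context d (T : measurableType d) (R : realType).
Variable mu : {measure set T -> \bar R}.


(* Borel measurability of T -> C, with C identified with R^2. *)
Definition cmeasurable (f : T -> R[i]) :=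
  measurable_fun [set: T] (fun x => complex.Re (f x)) /\
  measurable_fun [set: T] (fun x => complex.Im (f x)).

Definition L2norm (f : T -> R[i]) : \bar R := 'N[mu]_2%:E[EFin \o (@normc R \o f)]%E.

Definition L2fun : {pred T -> R[i]} :=
  fun f => `[< cmeasurable f /\ (L2norm f < +oo)%E >].

Lemma L2funP f : reflect (cmeasurable f /\ (L2norm f < +oo)%E) (f \in L2fun).
Proof. exact: asboolP. Qed.

Lemma measurable_fun_powR (h : T -> R) p : measurable_fun [set: T] h ->
  measurable_fun [set: T] (fun x => h x `^ p).
Proof. exact: (@measurableT_comp _ _ _ _ _ _ (@powR R ^~ p)). Qed.

Lemma measurable_normc f : cmeasurable f ->
  measurable_fun [set: T] (fun x => normc (f x)).
Proof.
move=> [mr mi].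
rewrite (_ : (fun x => _) =
  (fun x => (complex.Re (f x) ^+ 2 + complex.Im (f x) ^+ 2) `^ (2^-1))); last first.
  by apply/funext => x; rewrite powR12_sqrt ?addr_ge0 ?sqr_ge0//; case: (f x).
apply: measurable_fun_powR.
by apply: measurable_funD; exact: measurable_funX.
Qed.

Lemma normc_ge0 (z : R[i]) : 0 <= normc z.
Proof. by case: z => a b /=; exact: sqrtr_ge0. Qed.

Lemma norm_normc (z : R[i]) : `|z| = (normc z)%:C.
Proof. by case: z => a b; rewrite normc_def. Qed.

Lemma le_normcD (z w : R[i]) : normc (z + w) <= normc z + normc w.
Proof. by rewrite -lecR rmorphD/= -!norm_normc ler_normD. Qed.

Lemma cmeasurableD (f g : T -> R[i]) : cmeasurable f -> cmeasurable g -> cmeasurable (f + g).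
Proof.
move=> [fr fi] [gr gi]; split.
- rewrite (_ : (fun x => _) = (fun x => complex.Re (f x) + complex.Re (g x))).
    exact: measurable_funD.
  by apply/funext => x; rewrite -raddfD.
- rewrite (_ : (fun x => _) = (fun x => complex.Im (f x) + complex.Im (g x))).
    exact: measurable_funD.
  by apply/funext => x; rewrite -raddfD.
Qed.

Lemma cmeasurableM (f g : T -> R[i]) : cmeasurable f -> cmeasurable g ->
  cmeasurable (fun x => f x * g x).
Proof.
move=> [fr fi] [gr gi]; split.
- rewrite (_ : (fun x => _) =
    (fun x => complex.Re (f x) * complex.Re (g x) - complex.Im (f x) * complex.Im (g x))).
    by apply: measurable_funB; exact: measurable_funM.
  by apply/funext => x; case: (f x) (g x) => a b [].
- rewrite (_ : (fun x => _) =
    (fun x => complex.Re (f x) * complex.Im (g x) + complex.Im (f x) * complex.Re (g x))).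
    by apply: measurable_funD; exact: measurable_funM.
  by apply/funext => x; case: (f x) (g x) => a b [].
Qed.

Lemma L2norm_ge0 f : (0 <= L2norm f)%E.
Proof. exact: Lnorm_ge0. Qed.

Lemma L2normE f : L2norm f =
  ((\int[mu]_x ((normc (f x) `^ 2)%:E)) `^ 2^-1)%E.
Proof.
rewrite /L2norm unlock; congr (_ `^ _)%E; apply: eq_integral => x _.
by rewrite /= ger0_norm// normc_ge0.
Qed.

Lemma le_L2norm (f g : T -> R[i]) : cmeasurable f -> cmeasurable g ->
  {ae mu, forall x, normc (f x) <= normc (g x)} -> (L2norm f <= L2norm g)%E.
Proof.
move=> mf mg fg; rewrite !L2normE.
apply: gt0_ler_poweR => //.
- by rewrite in_itv/= leey andbT integral_ge0 // => x _; rewrite lee_fin powR_ge0.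
- by rewrite in_itv/= leey andbT integral_ge0 // => x _; rewrite lee_fin powR_ge0.
have mp (h : T -> R[i]) : cmeasurable h ->
    measurable_fun [set: T] (fun x => (normc (h x) `^ 2)%:E).
  move=> mh; apply/measurable_EFinP.
  exact: measurable_fun_powR (measurable_normc mh).
apply: ae_ge0_le_integral => //; [|exact: mp| |exact: mp|].
- by move=> x _; rewrite lee_fin powR_ge0.
- by move=> x _; rewrite lee_fin powR_ge0.
- apply: filterS fg => x fgx _; rewrite lee_fin.
  by apply: ge0_ler_powR => //; rewrite nnegrE normc_ge0.
Qed.

Lemma eq_L2norm (f g : T -> R[i]) : cmeasurable f -> cmeasurable g ->
  {ae mu, forall x, normc (f x) = normc (g x)} -> L2norm f = L2norm g.
Proof.
move=> mf mg fg; apply/eqP; rewrite eq_le; apply/andP; split.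
- by apply: le_L2norm => //; apply: filterS fg => x ->.
- by apply: le_L2norm => //; apply: filterS fg => x ->.
Qed.

Lemma le_L2normD (f g : T -> R[i]) : cmeasurable f -> cmeasurable g ->
  (L2norm (f + g)%R <= L2norm f + L2norm g)%E.
Proof.
move=> mf mg.
have mnf := measurable_normc mf; have mng := measurable_normc mg.
apply: le_trans (@minkowski_EFin _ _ _ mu _ _ 2 mnf mng _); last by rewrite ler1n.
pose h x : R[i] := (normc (f x) + normc (g x))%:C.
have nh x : normc (h x) = normc (f x) + normc (g x).
  by rewrite /h/= expr0n/= addr0 sqrtr_sqr ger0_norm// addr_ge0// normc_ge0.
have -> : 'N[mu]_2%:E[EFin \o ((fun x => normc (f x)) \+
                              (fun x => normc (g x)))%R]%E = L2norm h.
  by rewrite /L2norm; congr Lnorm; apply/funext => x; congr EFin; exact: esym (nh x).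
apply: le_L2norm; first exact: cmeasurableD.
- by split; [exact: measurable_funD | exact: measurable_cst].
- by apply: aeW => x; rewrite nh le_normcD.
Qed.

Lemma L2normZ a (f : T -> R[i]) : cmeasurable f ->
  L2norm (a *: f) = ((normc a)%:E * L2norm f)%E.
Proof.
move=> mf; rewrite !L2normE.
have -> : (\int[mu]_x ((normc ((a *: f) x) `^ 2)%:E) =
    (normc a `^ 2)%:E * \int[mu]_x ((normc (f x) `^ 2)%:E))%E.
  rewrite -ge0_integralZl_EFin ?powR_ge0//.
  - apply: eq_integral => x _.
    by rewrite /= -EFinM -powRM ?normc_ge0// -normcM.
  - by move=> x _; rewrite lee_fin powR_ge0.
  - apply/measurable_EFinP.
    exact: measurable_fun_powR (measurable_normc mf).
rewrite poweRM ?lee_fin ?powR_ge0//; last first.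
  by apply: integral_ge0 => x _; rewrite lee_fin powR_ge0.
by rewrite /= -powRrM divff// powRr1// normc_ge0.
Qed.

Lemma cmeasurable_cst (c : R[i]) : cmeasurable (fun=> c).
Proof. by split; exact: measurable_cst. Qed.

Lemma L2fun_submod_closed : submod_closed L2fun.
Proof.
have cZ a (f : T -> R[i]) : cmeasurable f -> cmeasurable (a *: f).
  by move=> mf; apply: cmeasurableM => //; exact: cmeasurable_cst.
split.
- apply/L2funP; split; first exact: cmeasurable_cst.
  rewrite /L2norm (_ : EFin \o _ = cst 0%E) ?Lnorm0//.
  by apply/funext => x /=; rewrite expr0n/= addr0 sqrtr0.
- move=> a f g /L2funP[mf fy] /L2funP[mg gy]; apply/L2funP.
  split; first by apply: cmeasurableD => //; exact: cZ.
  apply: le_lt_trans (le_L2normD _ _) _ => //; first exact: cZ.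
  rewrite lte_add_pinfty// L2normZ// lte_mul_pinfty// ?lee_fin ?normc_ge0//.
Qed.

HB.instance Definition _ :=
  GRing.isSubmodClosed.Build R[i] (T -> R[i]) L2fun L2fun_submod_closed.

Record L2fun_type := L2Fun { L2val :> T -> R[i] ; _ : L2val \in L2fun }.

HB.instance Definition _ := [isSub for L2val].
HB.instance Definition _ := [Choice of L2fun_type by <:].
HB.instance Definition _ := [SubChoice_isSubLmodule of L2fun_type by <:].

Definition L2null : {pred L2fun_type} :=
  fun f => `[< {ae mu, forall x, f x = 0} >].

Lemma L2null_zmod_closed : zmod_closed L2null.
Proof.
split; first by apply/asboolP; exact: aeW.
move=> f g /asboolP f0 /asboolP g0; apply/asboolP.
by apply: filterS2 f0 g0 => x fx gx; rewrite (_ : L2val _ x = f x - g x)// fx gx subr0.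
Qed.

HB.instance Definition _ :=
  GRing.isZmodClosed.Build L2fun_type L2null L2null_zmod_closed.

(* L^2(mu, C): square-integrable functions modulo a.e. equality *)
Definition L2space : Type := Quotient.quot L2null.
HB.instance Definition _ := Choice.on L2space.
HB.instance Definition _ := EqQuotient.on L2space.
HB.instance Definition _ := GRing.Zmodule.on L2space.


Definition L2class (f : L2fun_type) : L2space := \pi_L2space f.

(* a representative, defined up to a mu-null set *)
Definition L2repr (u : L2space) : L2fun_type := repr u.
Coercion L2repr : L2space >-> L2fun_type.

Lemma L2classP (f g : L2fun_type) :
  L2class f = L2class g <-> {ae mu, forall x, f x = g x}.
Proof.
split=> [/eqP|fg].
- rewrite -Quotient.idealrBE => /asboolP; apply: filterS => x.
  by rewrite (_ : L2val _ x = f x - g x)// => /eqP; rewrite subr_eq0 => /eqP.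
- apply/eqP; rewrite -Quotient.idealrBE; apply/asboolP.
  by apply: filterS fg => x fg; rewrite (_ : L2val _ x = f x - g x)// fg subrr.
Qed.

Lemma L2reprK (u : L2space) : L2class (L2repr u) = u.
Proof. exact: reprK. Qed.

Lemma L2classK (f : L2fun_type) : {ae mu, forall x, L2class f x = f x}.
Proof. by apply/L2classP; rewrite L2reprK. Qed.

Lemma L2classD (f g : L2fun_type) : L2class (f + g) = L2class f + L2class g.
Proof. exact: raddfD. Qed.

Definition L2scale (a : R[i]) (u : L2space) : L2space := L2class (a *: L2repr u).

Lemma L2scale_class a (f : L2fun_type) : L2scale a (L2class f) = L2class (a *: f).
Proof.
apply/L2classP; apply: filterS (L2classK f) => x fx.
by rewrite (_ : L2val _ x = a * L2class f x)// fx.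
Qed.

Lemma L2scaleA a b u : L2scale a (L2scale b u) = L2scale (a * b) u.
Proof. by rewrite -(L2reprK u) !L2scale_class scalerA. Qed.

Lemma L2scale1 : left_id 1 L2scale.
Proof. by move=> u; rewrite -(L2reprK u) L2scale_class scale1r. Qed.

Lemma L2scaleDr : right_distributive L2scale +%R.
Proof.
move=> a u v; rewrite -(L2reprK u) -(L2reprK v) -L2classD !L2scale_class.
by rewrite scalerDr L2classD.
Qed.

Lemma L2scaleDl u : {morph L2scale^~ u : a b / a + b}.
Proof.
by move=> a b; rewrite -(L2reprK u) !L2scale_class scalerDl L2classD.
Qed.

HB.instance Definition _ :=
  GRing.Zmodule_isLmodule.Build R[i] L2space L2scaleA L2scale1 L2scaleDr L2scaleDl.

(* The norm is a real number, seen as an element of R[i]. *)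
Definition L2nrm (u : L2space) : R[i] := (fine (L2norm u))%:C.

Lemma L2fun_cmeasurable (f : L2fun_type) : cmeasurable f.
Proof. by case: f => f /= /L2funP[]. Qed.

Lemma L2fun_fin_num (f : L2fun_type) : L2norm f \is a fin_num.
Proof. by case: f => f /= /L2funP[_ fy]; rewrite ge0_fin_numE// L2norm_ge0. Qed.

Lemma L2norm_class (f : L2fun_type) : L2norm (L2class f) = L2norm f.
Proof.
apply: eq_L2norm; [exact: L2fun_cmeasurable..|].
by apply: filterS (L2classK f) => x ->.
Qed.

Lemma ler_L2nrmD (u v : L2space) : L2nrm (u + v) <= L2nrm u + L2nrm v.
Proof.
rewrite /L2nrm -(L2reprK u) -(L2reprK v) -L2classD !L2norm_class.
rewrite -rmorphD/= lecR -lee_fin EFinD !fineK ?L2fun_fin_num //.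
  by apply: le_L2normD; exact: L2fun_cmeasurable.
exact: L2fun_fin_num (L2repr u + L2repr v).
Qed.

Lemma L2nrmZ a (u : L2space) : L2nrm (a *: u) = `|a| * L2nrm u.
Proof.
rewrite /L2nrm -(L2reprK u) [_ *: _]L2scale_class !L2norm_class.
rewrite norm_normc -rmorphM/=; congr (_%:C).
rewrite (_ : L2norm _ = L2norm (a *: L2val u))// L2normZ ?fineM ?L2fun_fin_num//.
exact: L2fun_cmeasurable.
Qed.

Lemma L2nrm0_eq0 (u : L2space) : L2nrm u = 0 -> u = 0.
Proof.
rewrite -{2}(L2reprK u) => -[u0].
have {}u0 : L2norm u = 0%E by rewrite -(fineK (L2fun_fin_num u)) u0.
rewrite -[RHS](@raddf0 _ _ \pi_L2space); apply/L2classP.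
have mu_ : measurable_fun [set: T] (EFin \o (@normc R \o L2repr u)).
  by apply/measurable_EFinP/measurable_normc/L2fun_cmeasurable.
have p2 : (0 < (2%:R : R)%:E)%E by rewrite lte_fin ltr0n.
apply: filterS (Lnorm_eq0_eq0 mu_ p2 u0) => x /(_ I) [].
exact: eq0_normc.
Qed.

HB.instance Definition _ :=
  Lmodule_isNormed.Build R[i] L2space ler_L2nrmD L2nrmZ L2nrm0_eq0.

End L2_functions.

(* Total variation: supremum over the finite measurable partitions of T. *)
Definition measure_norm d (T : measurableType d) (R : realType)
    (nu : set T -> \bar R) : \bar R :=
  ereal_sup [set s | exists n (E : 'I_n -> set T),
    [/\ forall i, measurable (E i), trivIset [set: 'I_n] E,
        \bigcup_i E i = [set: T] & s = (\sum_(i < n) `|nu (E i)|)%E]].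

Definition cintegral d (T : measurableType d) (R : realType)
    (nu : {measure set T -> \bar R}) (f : T -> R[i]) : R[i] :=
  (\int[nu]_x complex.Re (f x))%R +i* (\int[nu]_x complex.Im (f x))%R.

Definition expi {R : realType} (a : R) : R[i] := cos a +i* sin a.

Definition fourier (R : realType)
    (nu : {measure set (measurableTypeR R) -> \bar R}) (xi : R) : R[i] :=
  cintegral nu (fun x => expi (- (xi * x))).

Section oscillators.
Variables (R : realType) (mu : {measure set (measurableTypeR R) -> \bar R}).

Lemma normc_expi (a : R) : normc (expi a) = 1.
Proof. by rewrite /= cos2Dsin2 sqrtr1. Qed.

Lemma cmeasurable_expi (t : R) :
  cmeasurable (fun x : measurableTypeR R => expi (t * x)).
Proof.
have mt : measurable_fun [set: measurableTypeR R] (fun x : R => t * x).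
  exact: measurable_funM.
split; apply: (measurableT_comp _ mt).
- exact: continuous_measurable_fun (@continuous_cos R).
- exact: continuous_measurable_fun (@continuous_sin R).
Qed.

Lemma flow_subproof (t : R) (v : L2space mu) :
  (fun x => expi (t * x) * v x) \in L2fun mu.
Proof.
have mv := cmeasurableM (cmeasurable_expi t) (L2fun_cmeasurable v).
apply/L2funP; split => //.
rewrite (eq_L2norm mv (L2fun_cmeasurable v)); last first.
  by apply: aeW => x; rewrite normcM normc_expi mul1r.
by rewrite -ge0_fin_numE ?L2fun_fin_num ?L2norm_ge0.
Qed.

Definition flow (t : R) (v : L2space mu) : L2space mu :=
  L2class (L2Fun (flow_subproof t v)).

Lemma flowE t v : {ae mu, forall x, flow t v x = expi (t * x) * v x}.
Proof. exact: L2classK. Qed.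

Definition invariant_torus (u : L2space mu) : set (L2space mu) :=
  [set v | {ae mu, forall x, `|v x| = `|u x|}].

Definition trajectory (u : L2space mu) : set (L2space mu) :=
  [set flow t u | t in [set: R]].

Lemma trajectory_torus u : trajectory u `<=` invariant_torus u.
Proof.
move=> _ [t _ <-]; apply: filterS (flowE t u) => x ->.
by rewrite !norm_normc normcM normc_expi mul1r.
Qed.

(* As trajectory u is included in invariant_torus u, this is density of
   trajectory u for the topology induced on invariant_torus u. *)
Definition transitive_trajectory (u : L2space mu) : Prop :=
  invariant_torus u `<=` closure (trajectory u).

End oscillators.

(* Main.v *)
Require Import Defs.
From mathcomp Require Import all_boot all_order all_algebra.
From mathcomp Require Import all_classical all_reals all_analysis.
From mathcomp Require Import measurable_realfun complex lra ring.

Set Implicit Arguments.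
Unset Strict Implicit.
Unset Printing Implicit Defensive.

Import Order.TTheory GRing.Theory Num.Theory.
Import numFieldNormedType.Exports.

Local Open Scope classical_set_scope.
Local Open Scope ring_scope.

(** Let [u] have a dense trajectory in its invariant torus. The torus contains
[- u], so there are times [t] at which [exp(itx) u(x)] is as close as desired
to [- u(x)] in L^2, i.e. [exp(itx)] is close to [-1] on average where [u]
does not vanish. Since [mu] is finite, one may retreat to a bounded set [A] of
positive measure on which [|u|] is bounded below ([exists n, mu (core u n) <> 0],
by [ae_core0]); there, with [nu] the restriction of [mu] to [A], the integral of
[1 + cos (t x)] against [nu] can be made arbitrarily small
([flow_antipode_core]).

A [t] making this integral small cannot be too close to [0]: [A] is bounded, so for small [t] one has
[cos (t x) >= 0] on [A] and the integral is at least the mass of [nu]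
([integral_onep_cos_ge]). Hence all good times satisfy [b <= |t|] for one fixed
[b > 0], and the multiples [2^(n+1) |t|] can be pushed beyond any bound by a
choice of [n] made before [t]. At such a multiple [exp(i 2^(n+1) t x)] is close
to [(-1)^(2^(n+1)) = 1]; quantitatively, [onem_cos_dyadic] bounds the loss by
the factor [4^(n+1)], which the choice of [t] then absorbs. So the Fourier
transform of [nu] comes arbitrarily close to the mass of [nu] at arbitrarily
large times ([fourier_dyadic_ge]); it never exceeds this mass ([le_fourier]),
whence the value of the limsup ([limsup_fourier]).

Taking [- u] as the target and then even multiples settles at once the two ways
in which closeness to [u] itself would be uninformative: the time [t = 0], and
return times that stay bounded, as happens for a periodic trajectory. *)

(** * Doubling the angle *)

(** Doubling the angle multiplies [1 - cos] by at most 4, because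
[1 - cos (2 y) = 2 (1 - cos y) (1 + cos y)]; the same formula with the roles of
the two factors exchanged turns closeness to [-1] into closeness to [1] at the
first doubling. *)
Lemma onem_cos_dyadic (R : realType) (x : R) n :
  1 - cos (2 ^+ n.+1 * x) <= 4 ^+ n.+1 * (1 + cos x).
Proof.
have cos2 (y : R) : cos (2 * y) = 2 * cos y ^+ 2 - 1.
  by rewrite !mulr_natl cos_mulr2n.
elim: n => [|n IHn].
  by rewrite !expr1 cos2; have := sqr_ge0 (1 + cos x); lra.
rewrite exprS -mulrA cos2 [4 ^+ _]exprS -mulrA.
by have := sqr_ge0 (1 - cos (2 ^+ n.+1 * x)); lra.
Qed.

(** * Fourier transform of a finite measure *)

Section finite_measure.
Variable R : realType.
Notation BR := (measurableTypeR R).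
Variable nu : {finite_measure set BR -> \bar R}.

Lemma integrable_trig (f : R -> R) (t : R) : continuous f ->
  (forall x, `|f x| <= 1) ->
  nu.-integrable [set: BR] (EFin \o (fun x : BR => f (t * x))).
Proof.
move=> cf f1; apply: measurable_bounded_integrable => //.
- exact: fin_num_fun_lty.
- apply: measurableT_comp; last exact: measurable_funM.
  exact: continuous_measurable_fun.
- exists 1; split; first exact: num_real.
  by move=> x x1 y _ /=; exact: le_trans (f1 _) (ltW x1).
Qed.

Lemma integrable_cos (t : R) :
  nu.-integrable [set: BR] (EFin \o (fun x : BR => cos (t * x))).
Proof.
apply: integrable_trig; first exact: continuous_cos.
by move=> x; rewrite ler_norml cos_geN1 cos_le1.
Qed.

Lemma integrable_sin (t : R) :
  nu.-integrable [set: BR] (EFin \o (fun x : BR => sin (t * x))).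
Proof.
apply: integrable_trig; first exact: continuous_sin.
by move=> x; rewrite ler_norml sin_geN1 sin_le1.
Qed.

Lemma integrable_constant (r : R) :
  nu.-integrable [set: BR] (EFin \o (fun=> r)).
Proof. exact: finite_measure_integrable_cst. Qed.

Lemma integrable_onep_cos t :
  nu.-integrable [set: BR] (EFin \o (fun x : BR => 1 + cos (t * x))).
Proof.
exact: (integrableD measurableT (integrable_constant 1) (integrable_cos t)).
Qed.

Lemma fourierE t : fourier nu t =
  Complex (\int[nu]_x cos (t * x))%R (- \int[nu]_x sin (t * x))%R.
Proof.
congr Complex.
  by apply: eq_Rintegral => x _ /=; rewrite cosN.
rewrite -[RHS]mulN1r -RintegralZl//; last exact: integrable_sin.
by apply: eq_Rintegral => x _ /=; rewrite sinN mulN1r.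
Qed.

(** Writing the value as [c - i s] and [r] for its modulus, [r ^ 2] is the integral
of [c cos (t x) + s sin (t x)], which Cauchy-Schwarz in the plane bounds
pointwise by [r]. *)
Lemma le_fourier t :
  ComplexField.Normc.normc (fourier nu t) <= fine (nu [set: BR]).
Proof.
rewrite fourierE /= sqrrN.
set c := (\int[nu]_x cos (t * x))%R; set s := (\int[nu]_x sin (t * x))%R.
set r := Num.sqrt _.
have r2 : r ^+ 2 = c ^+ 2 + s ^+ 2 by rewrite sqr_sqrtr ?addr_ge0 ?sqr_ge0.
have r0 : 0 <= r by exact: sqrtr_ge0.
have ic a := integrableZl measurableT a (integrable_cos t).
have is_ a := integrableZl measurableT a (integrable_sin t).
have : r ^+ 2 <= r * fine (nu [set: BR]).
  have -> : r ^+ 2 = (\int[nu]_x (c * cos (t * x) + s * sin (t * x)))%R.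
    rewrite (RintegralD measurableT (ic c) (is_ s)).
    rewrite (RintegralZl c measurableT (integrable_cos t)).
    by rewrite (RintegralZl s measurableT (integrable_sin t)) r2 -!expr2.
  rewrite -Rintegral_cst//; apply: le_Rintegral => //.
  - exact: (integrableD measurableT (ic c) (is_ s)).
  - exact: integrable_constant.
  move=> x _; apply: le_trans (ler_norm _) _.
  rewrite -(@ler_pXn2r _ 2)// ?nnegrE// r2 real_normK ?num_real//.
  have -> : c ^+ 2 + s ^+ 2 = (c ^+ 2 + s ^+ 2) * (cos (t * x) ^+ 2 + sin (t * x) ^+ 2).
    by rewrite cos2Dsin2 mulr1.
  by have := sqr_ge0 (c * sin (t * x) - s * cos (t * x)); nra.
rewrite expr2; have [->|r1] := eqVneq r 0; first by rewrite fine_ge0.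
by rewrite ler_pM2l// lt_def r1.
Qed.

(** The real part of the transform alone reaches this bound, and it is even in
[t]: hence the absolute value, which makes the time positive. *)
Lemma fourier_dyadic_ge t n :
  fine (nu [set: BR]) - 4 ^+ n.+1 * (\int[nu]_x (1 + cos (t * x)))%R <=
  ComplexField.Normc.normc (fourier nu (2 ^+ n.+1 * `|t|)).
Proof.
rewrite fourierE.
have [i1 ic] := (integrable_constant 1, integrable_cos).
have id := integrable_onep_cos t.
apply: (@le_trans _ _ (\int[nu]_x cos (2 ^+ n.+1 * `|t| * x))%R); last first.
  rewrite /=; apply: le_trans (ler_norm _) _.
  by rewrite -sqrtr_sqr ler_wsqrtr// lerDl sqr_ge0.
rewrite -[fine _]mul1r -Rintegral_cst// -RintegralZl// -RintegralB//=; last first.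
  exact: (integrableZl measurableT _ id).
apply: le_Rintegral => //.
  exact: (integrableB measurableT i1 (integrableZl measurableT _ id)).
move=> x _; rewrite lerBlDr addrC -lerBlDr.
have -> : cos (2 ^+ n.+1 * `|t| * x) = cos (2 ^+ n.+1 * (t * x)).
  by have [//|t0] := ger0P t; rewrite ?mulrA// mulrN mulNr cosN.
exact: onem_cos_dyadic.
Qed.

(** The lower bound [b] on [|t|] lets the number of doublings be fixed from the
time to be exceeded, before [t] is chosen; this is why the accuracy requested
of [t] may depend on that number. *)
Lemma limsup_fourier (b : R) : 0 < b ->
  (forall e, 0 < e -> exists2 t, b <= `|t| &
     (\int[nu]_x (1 + cos (t * x)))%R <= e) ->
  limf_esup (fun t : R => (ComplexField.Normc.normc (fourier nu t))%:E)
    (pinfty_nbhs R) = nu [set: BR].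
Proof.
move=> b0 H; have nufin : nu [set: BR] \is a fin_num by exact: fin_num_measure.
rewrite limf_esupE; apply/eqP; rewrite eq_le; apply/andP; split.
  apply: (@le_trans _ _ (ereal_sup [set (ComplexField.Normc.normc (fourier nu t))%:E | t in [set: R]])).
    by apply: ereal_inf_lbound; exists setT => //; exact: filterT.
  apply: ge_ereal_sup => _ [t _ <-].
  by rewrite -(fineK nufin) lee_fin le_fourier.
apply: le_ereal_inf_tmp => _ [V [M [_ MV]] <-].
apply/lee_addgt0Pr => e e0.
have [n] : exists n, M < 2 ^+ n.+1 * b.
  have /archi_boundP := normr_ge0 (M / b).
  set n := Num.bound _ => Mn; exists n.
  rewrite -ltr_pdivrMr//; apply: le_lt_trans (ler_norm _) _.
  apply: lt_le_trans Mn _.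
  by rewrite -natrX ler_nat ltnW// ltnW// ltn_expl.
move=> Mn.
have p4 : 0 < 4 ^+ n.+1 :> R by exact: exprn_gt0.
(* the accuracy compensates the loss of 4 ^ (n + 1) in [fourier_dyadic_ge] *)
have [t bt te] := H (e / 4 ^+ n.+1) (divr_gt0 e0 p4).
apply: (@le_trans _ _ ((ComplexField.Normc.normc (fourier nu (2 ^+ n.+1 * `|t|)))%:E + e%:E)%E).
  rewrite -(fineK nufin) -EFinD lee_fin -lerBlDr.
  apply: le_trans (fourier_dyadic_ge t n).
  by rewrite lerB// mulrC -ler_pdivlMr.
rewrite leeD2r//; apply: ereal_sup_ubound; exists (2 ^+ n.+1 * `|t|) => //.
apply: MV; apply: lt_le_trans Mn _.
by rewrite ler_pM2l// exprn_gt0.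
Qed.

(** If [nu] lives on [[-a, a]], then [|t x| <= 1 < pi / 2] almost everywhere as
soon as [|t| a <= 1]. *)
Lemma integral_onep_cos_ge (a t : R) :
  {ae nu, forall x, `|x| <= a} -> `|t| * a <= 1 ->
  fine (nu [set: BR]) <= (\int[nu]_x (1 + cos (t * x)))%R.
Proof.
move=> xa ta.
have id := integrable_onep_cos t.
rewrite -[fine _]mul1r -Rintegral_cst//; apply: fine_le.
- exact: integrable_fin_num (integrable_constant 1).
- exact: integrable_fin_num id.
apply: ae_ge0_le_integral => //.
  exact: measurable_int id.
apply: (@filterS _ _ (ae_filter_ringOfSetsType nu) _ _ _ xa) => x {}xa _.
rewrite lee_fin lerDl.
apply: cos_ge0_pihalf; rewrite -ler_norml normrM.
apply: le_trans (ler_wpM2l (normr_ge0 t) xa) (le_trans ta _).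
exact: pihalf_ge1.
Qed.

End finite_measure.

(** * Total variation and restriction of measures *)

Lemma measure_norm_setT d (T : measurableType d) (R : realType)
    (nu : {measure set T -> \bar R}) : measure_norm nu = nu [set: T].
Proof.
apply/eqP; rewrite eq_le; apply/andP; split.
  apply: ge_ereal_sup => _ [n [E [mE tE UE ->]]].
  rewrite (eq_bigr (fun i => nu (E i))) => [|i _]; last exact: gee0_abs.
  rewrite -measure_bigsetU_ord//; apply: le_measure; rewrite ?inE//.
  exact: bigsetU_measurable.
apply: ereal_sup_ubound; exists 1%N, (fun=> setT); split => //.
- by apply/trivIsetP => i j _ _; rewrite (ord1 i) (ord1 j) eqxx.
- by apply/seteqP; split => // x _; exists ord0.
- by rewrite big_ord1 gee0_abs.
Qed.

Lemma ae_mrestr d (T : measurableType d) (R : realType)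
    (mu : {measure set T -> \bar R}) (A : set T) (mA : measurable A)
    (P : T -> Prop) :
  {ae mu, forall x, A x -> P x} -> {ae mrestr mu mA, forall x, P x}.
Proof.
move=> [N [mN N0 PN]]; exists (N `|` ~` A); split.
- by apply: measurableU => //; exact: measurableC.
- rewrite /mrestr setIUl setICl setU0; apply/eqP.
  rewrite -measure_le0 -N0; apply: le_measure; rewrite ?inE//.
  exact: measurableI.
- move=> x Px; have [Ax|] := pselect (A x); last by right.
  by left; apply: PN => /(_ Ax).
Qed.

(** * Bounded sets on which a function is bounded away from zero *)

Section core.
Local Open Scope complex_scope.
Variable R : realType.
Notation BR := (measurableTypeR R).
Notation normc := ComplexField.Normc.normc.

(** The two bounds serve different purposes: the one on [f] converts smallness of
an integral weighted by [|f|^2] into smallness of the unweighted one, the one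
on [x] keeps [t x] small for small [t]. One index governs both, so that these
sets form an increasing sequence exhausting the set where [f] is nonzero. *)
Definition core (f : BR -> R[i]) (n : nat) : set BR :=
  [set x | n.+1%:R^-1 <= normc (f x) /\ `|x : R| <= n.+1%:R].

Lemma measurable_core (f : BR -> R[i]) n : cmeasurable f -> measurable (core f n).
Proof.
move=> /measurable_normc mf.
have -> : core f n = ([set: BR] `&` (fun x => normc (f x)) @^-1` `[n.+1%:R^-1, +oo[) `&`
    ([set: BR] `&` (@Num.norm R R) @^-1` `]-oo, n.+1%:R]).
  by apply/seteqP; split => x /=; rewrite !in_itv/= andbT; [move=> [] | move=> [[_ ?] [_ ?]]].
apply: measurableI; first exact: mf.
exact: (@normr_measurable R setT).
Qed.

Lemma ae_core0 (mu : {measure set BR -> \bar R}) (f : BR -> R[i]) :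
  cmeasurable f -> (forall n, mu (core f n) = 0%E) -> {ae mu, forall x, f x = 0}.
Proof.
move=> mf A0; apply: (@negligibleS _ _ _ _ (\bigcup_n core f n)).
  move=> x /= /eqP fx0.
  have fx : 0 < normc (f x).
    rewrite lt_def normc_ge0 andbT; apply/eqP => /ComplexField.Normc.eq0_normc fx.
    by rewrite fx eqxx in fx0.
  (* the sum exceeds both quantities that n + 1 has to dominate *)
  have := archi_boundP (addr_ge0 (ltW (divr_gt0 ltr01 fx)) (normr_ge0 (x : R))).
  set n := Num.bound _ => xn; exists n => //.
  have {}xn : (normc (f x))^-1 + `|x : R| <= n.+1%:R.
    by rewrite -div1r; apply: le_trans (ltW xn) _; rewrite ler_nat.
  split; last by apply: le_trans xn; rewrite lerDr invr_ge0 ltW.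
  rewrite -[leRHS]invrK lef_pV2 ?posrE ?invr_gt0//.
  by apply: le_trans xn; rewrite lerDl.
apply: negligible_bigcup => n; apply/negligibleP; last exact: A0.
exact: measurable_core.
Qed.

End core.

(** * Representatives of classes in L^2 *)

Section L2_representatives.
Local Open Scope complex_scope.
Context d (T : measurableType d) (R : realType).
Variable mu : {measure set T -> \bar R}.
Notation normc := ComplexField.Normc.normc.

Lemma L2oppE (u : L2space mu) : {ae mu, forall x, L2repr (- u) x = - L2repr u x}.
Proof.
have -> : - u = L2class (- L2repr u) by rewrite -[in LHS](L2reprK u); exact/esym/raddfN.
exact: L2classK.
Qed.

Lemma L2subE (u v : L2space mu) :
  {ae mu, forall x, L2repr (u - v) x = L2repr u x - L2repr v x}.
Proof.
have -> : u - v = L2class (L2repr u - L2repr v).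
  by rewrite -[in LHS](L2reprK u) -[in LHS](L2reprK v); exact/esym/raddfB.
exact: L2classK.
Qed.

Lemma L2null_eq0 (u : L2space mu) : {ae mu, forall x, u x = 0} -> u = 0.
Proof.
move=> u0; have <- : L2class (0 : L2fun_type mu) = 0 :> L2space mu by exact: raddf0.
by rewrite -(L2reprK u); apply/L2classP.
Qed.

Lemma integral_normc2_le (f : T -> R[i]) (e : R) : 0 <= e ->
  (L2norm mu f <= e%:E)%E ->
  (\int[mu]_x ((normc (f x) `^ 2)%:E) <= (e ^+ 2)%:E)%E.
Proof.
move=> e0; rewrite L2normE; set I := (\int[mu]_x _)%E => Ie.
have I0 : (0 <= I)%E by apply: integral_ge0 => x _; rewrite lee_fin powR_ge0.
have -> : I = ((I `^ 2^-1) `^ 2)%E by rewrite -poweRrM ?mulVf ?poweRe1.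
rewrite -powR_mulrn// -poweR_EFin.
apply: gt0_ler_poweR => //; by rewrite in_itv/= leey andbT ?poweR_ge0// lee_fin.
Qed.

End L2_representatives.

(** * Times at which the flow nearly reverses the state *)

Section antipode.
Local Open Scope complex_scope.
Variables (R : realType) (mu : {finite_measure set (measurableTypeR R) -> \bar R}).
Notation BR := (measurableTypeR R).
Notation normc := ComplexField.Normc.normc.

Lemma normc_onep_expi (x : R) : normc (1 + expi x) ^+ 2 = 2 * (1 + cos x).
Proof.
rewrite /= add0r sqr_sqrtr ?addr_ge0 ?sqr_ge0//.
by have := cos2Dsin2 x; nra.
Qed.

(** The square of [|- u - flow t u|] is the integral of [2 (1 + cos (t x)) |u|^2],
and [|u| >= 1 / (n + 1)] on [core u n]. *)
Lemma flow_antipode_core (u : L2space mu) (n : nat) (mA : measurable (core u n))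
    (t e : R) : 0 <= e -> `|- u - flow t u| < e%:C ->
  (\int[mrestr mu mA]_x (1 + cos (t * x)))%R <= (n.+1%:R * e) ^+ 2.
Proof.
move=> e0; rewrite -[`|_|]/(L2nrm _) ltcR -lte_fin fineK ?L2fun_fin_num// => ve.
set v := L2repr (- u - flow t u) in ve.
have mv : measurable_fun [set: BR] (fun x => (normc (v x) `^ 2)%:E).
  apply/measurable_EFinP/measurable_fun_powR/measurable_normc.
  exact: L2fun_cmeasurable.
have vE : {ae mu, forall x,
    normc (v x) `^ 2 = 2 * (1 + cos (t * x)) * normc (u x) ^+ 2}.
  apply: filterS3 (L2subE (- u) (flow t u)) (L2oppE u) (flowE t u) => x.
  rewrite -/v => -> -> ->.
  rewrite (_ : - u x - _ = - ((1 + expi (t * x)) * u x)); last by ring.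
  by rewrite powR_mulrn ?normc_ge0// normcN ComplexField.Normc.normcM exprMn normc_onep_expi.
have id := integrable_onep_cos (mrestr mu mA) t.
have N0 : 0 <= n.+1%:R ^+ 2 :> R by exact: exprn_ge0.
(* compare with the integral of [(n + 1)^2 |v|^2], first over the core, then over the whole line *)
rewrite -lee_fin /Rintegral fineK; last exact: integrable_fin_num id.
apply: (@le_trans _ _ (\int[mrestr mu mA]_x
    ((n.+1%:R ^+ 2)%:E * (normc (v x) `^ 2)%:E))%E).
  apply: ae_ge0_le_integral => //.
  - exact: measurable_int id.
  - by move=> x _; rewrite -EFinM lee_fin mulr_ge0// powR_ge0.
  - exact: measurable_funeM.
  apply: ae_mrestr; apply: filterS vE => x -> [ux _] _.
  rewrite -EFinM lee_fin.
  have : 1 <= (n.+1%:R * normc (u x)) ^+ 2.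
    by rewrite exprn_ege1// -ler_pdivrMl// mulr1.
  by rewrite exprMn; have := cos_geN1 (t * x); nra.
apply: (@le_trans _ _ (\int[mu]_x ((n.+1%:R ^+ 2)%:E * (normc (v x) `^ 2)%:E))%E).
  apply: ge0_le_measure_integral => //.
  - move=> S mS; rewrite /mrestr; apply: le_measure; rewrite ?inE//.
    exact: measurableI.
  - by move=> x; rewrite -EFinM lee_fin mulr_ge0// powR_ge0.
  - exact: measurable_funeM.
rewrite ge0_integralZl//; last by move=> x _; rewrite lee_fin powR_ge0.
rewrite exprMn [leRHS]EFinM lee_wpmul2l//.
exact: integral_normc2_le (ltW ve).
Qed.

Lemma transitive_near_antipode (u : L2space mu) : transitive_trajectory u ->
  forall e : R, 0 < e -> exists t, `|- u - flow t u| < e%:C.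
Proof.
move=> tu e e0.
have /tu /(_ (ball (- u) e%:C)) [] : invariant_torus u (- u).
  by apply: filterS (L2oppE u) => x ->; rewrite normrN.
- by apply: nbhsx_ballx; rewrite ltcR.
move=> _ [[t _ <-]]; rewrite -ball_normE => ?; by exists t.
Qed.

End antipode.

(** * Transitive trajectories force recurrence of the Fourier transform *)

Theorem corollary3p7 (R : realType)
    (mu : {finite_measure set (measurableTypeR R) -> \bar R}) :
  (exists u : L2space mu, u != 0 /\ transitive_trajectory u) ->
  exists (A : set (measurableTypeR R)) (mA : measurable A),
    [/\ (exists B : set (measurableTypeR R),
           measurable B /\ mrestr mu mA B != 0%E),
        limf_esup (fun t : R => (ComplexField.Normc.normc (fourier (mrestr mu mA) t))%:E)
          (pinfty_nbhs R) = measure_norm (mrestr mu mA)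
      & (0 < measure_norm (mrestr mu mA))%E].
Proof.
move=> [u [u0 tu]].
have mu_u := L2fun_cmeasurable (L2repr u).
have [n An0] : exists n, mu (core u n) != 0%E.
  apply: contrapT => /forallNP A0; move/eqP: u0; apply; apply: L2null_eq0.
  by apply: ae_core0 => // n; apply/eqP/negPn/negP/A0.
have mA := measurable_core n mu_u.
exists (core u n), mA; set nu := mrestr mu mA.
have nuT : nu [set: measurableTypeR R] = mu (core u n) by rewrite /nu /mrestr setTI.
have nu_gt0 : (0 < nu [set: measurableTypeR R])%E.
  by rewrite nuT lt0e An0 measure_ge0.
rewrite measure_norm_setT; split => //.
  by exists [set: measurableTypeR R]; split; rewrite // gt_eqF.
have m0 : 0 < fine (nu setT).
  by rewrite fine_gt0// nu_gt0 -ge0_fin_numE// fin_num_measure.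
apply: (@limsup_fourier _ _ n.+1%:R^-1); first by rewrite invr_gt0.
move=> e e0.
(* the second term makes times [t] with [|t| (n + 1) <= 1] impossible *)
pose e1 := Num.min e (fine (nu setT) / 2).
have e10 : 0 < e1 by rewrite lt_min e0 divr_gt0.
have d0 : 0 < Num.sqrt e1 / n.+1%:R by rewrite divr_gt0// sqrtr_gt0.
have [t /(flow_antipode_core mA (ltW d0))] := transitive_near_antipode tu d0.
rewrite mulrC divfK// sqr_sqrtr ?(ltW e10)// => te1.
exists t; last by apply: le_trans te1 _; rewrite ge_min lexx.
rewrite leNgt; apply/negP => tb.
have : fine (nu setT) <= fine (nu setT) / 2.
  apply: le_trans (le_trans te1 _); last by rewrite ge_min lexx orbT.
  apply: (@integral_onep_cos_ge _ _ n.+1%:R).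
    by apply: ae_mrestr; apply: aeW => x [].
  by rewrite -ler_pdivlMr// div1r ltW.
by rewrite leNgt ltr_pdivrMr// mulr_natr mulr2n ltrDl m0.
Qed.
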